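(* There exists a randomized reduction that, given a parameter $\phi\in\mathbb{Z}_+$ and an instance $(X,Y,\alpha,\beta)$ of the Gap Edit Distance problem ($X,Y\in\Sigma^n$) satisfying $\frac{1}{10}\alpha\ge\phi\ge\beta\ge1$, solves the instance using $\mathcal{O}(\frac{n}{\alpha})$ non-adaptive calls to an oracle for the Gap Edit Distance problem with parameters $(\phi,\beta)$, where the oracle calls are on pairs of substrings of $X$ and $Y$ of total length $\mathcal{O}(\frac{\phi n\log n}{\alpha})$. The reduction takes $\mathcal{O}(\frac{n}{\alpha})$ time, does not access the input strings (other than through the oracle calls), and errs with probability at most $\frac1e$ (assuming the oracle answers correctly).
   Context: $\mathsf{ED}(X,Y)$ is the edit distance. Gap Edit Distance with integer parameters $a\ge b\ge0$: given two equal-length strings $X,Y$, return YES if $\mathsf{ED}(X,Y)\le b$, NO if $\mathsf{ED}(X,Y)>a$, and an arbitrary answer otherwise. Non-adaptive calls: the set of oracle calls made does not depend on the oracle's answers. Logarithms base 2. *)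

(* Defs.v *)
From HB Require Import structures.
From mathcomp Require Import all_boot all_order all_algebra.
From mathcomp Require Import boolp reals sequences exp.

Set Implicit Arguments.
Unset Strict Implicit.
Unset Printing Implicit Defensive.

Import Order.TTheory GRing.Theory Num.Theory.

Section EditDistance.
Variable T : Type.

Inductive edit_step : seq T -> seq T -> Prop :=
| Insertion u a v : edit_step (u ++ v) (u ++ a :: v)
| Deletion u a v : edit_step (u ++ a :: v) (u ++ v)
| Substitution u a b v : edit_step (u ++ a :: v) (u ++ b :: v).

Inductive edits : nat -> seq T -> seq T -> Prop :=
| Edits0 x : edits 0 x x
| EditsS k x y z : edit_step x y -> edits k y z -> edits k.+1 x z.

Lemma edits_insert_all x y : edits (size y) x (y ++ x).
Proof.
suff H : forall z, edits (size y) (z ++ x) (z ++ y ++ x) by exact: (H [::]).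
elim: y => [|a y IHy] z /=; first exact: Edits0.
apply: EditsS (Insertion z a x) _.
by have := IHy (rcons z a); rewrite !cat_rcons.
Qed.

Lemma edits_exist x y : exists k, `[< edits k x y >].
Proof.
exists (size x + size y); apply/asboolP.
elim: x => [|a x IHx]; first by have := edits_insert_all [::] y; rewrite cats0.
exact: EditsS (Deletion [::] a x) IHx.
Qed.

Definition ED (x y : seq T) : nat := ex_minn (edits_exist x y).

(* Whether [ans] (YES = true) is an admissible answer on the instance [(x, y)]
   of Gap Edit Distance with parameters [a >= b]. *)
Definition gap_correct (a b : nat) (x y : seq T) (ans : bool) : bool :=
  ((ED x y <= b) ==> ans) && ((a < ED x y) ==> ~~ ans).

Definition gap_oracle (a b : nat) (O : seq T -> seq T -> bool) : Prop :=
  forall x y, size x = size y -> gap_correct a b x y (O x y).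

Definition substr (x : seq T) (i l : nat) : seq T := take l (drop i x).

End EditDistance.

(* An oracle call is a triple [(i, j, l)]: it asks about the length-[l]
   substring of X starting at [i] and the one of Y starting at [j]. *)
Definition query := (nat * nat * nat)%type.

Definition valid_query (n : nat) (q : query) : bool :=
  let: (i, j, l) := q in (i + l <= n) && (j + l <= n).

Definition query_length (q : query) : nat := let: (_, _, l) := q in l + l.

Definition answers (T : Type) (O : seq T -> seq T -> bool) (x y : seq T)
  (q : query) : bool :=
  let: (i, j, l) := q in O (substr x i l) (substr y j l).

(* A unit-cost word RAM with words of [w] bits, uniformly random words as coin
   tosses, and an oracle instruction. The memory initially holds only the
   numerical parameters: the input strings can influence a run only through
   the answers to the oracle calls. All operands are memory addresses, except
   the constant of [Const] and the jump target. Below, M is the memory. *)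
Inductive binop := Add | Sub | Mul | Div | Mod.

Inductive instr :=
| Const (d c : nat)               (* M[d] := c *)
| Op (o : binop) (d a b : nat)    (* M[d] := M[a] o M[b] *)
| Read (d a : nat)                (* M[d] := M[M[a]] *)
| Write (a b : nat)               (* M[M[a]] := M[b] *)
| Rand (d : nat)                  (* M[d] := next random word *)
| Call (d i j l : nat)            (* M[d] := answer to (M[i], M[j], M[l]) *)
| JumpLt (a b target : nat)       (* if M[a] < M[b] then goto target *)
| Halt (a : nat).                 (* stop; the answer is YES iff M[a] != 0 *)

Definition program := seq instr.

Record config := Config {
  pc : nat;
  mem : nat -> nat;
  tape : seq nat;          (* the unread random words *)
  calls : seq query;       (* the oracle calls made so far *)
  output : option bool     (* [Some _] once the machine has halted *)
}.

Definition upd (m : nat -> nat) (d v : nat) : nat -> nat :=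
  fun x => if x == d then v else m x.

(* Results are reduced modulo [2 ^ w]; as in ssrnat, subtraction is truncated
   and division by zero is total. *)
Definition eval_op (w : nat) (o : binop) (x y : nat) : nat :=
  match o with
  | Add => x + y
  | Sub => x - y
  | Mul => x * y
  | Div => x %/ y
  | Mod => x %% y
  end %% 2 ^ w.

Definition step (P : program) (w : nat) (ans : query -> bool) (s : config) :
  config :=
  let: Config p m r cs out := s in
  if out is Some _ then s else
  match onth P p with
  | None => s
  | Some (Const d c) => Config p.+1 (upd m d (c %% 2 ^ w)) r cs None
  | Some (Op o d a b) =>
      Config p.+1 (upd m d (eval_op w o (m a) (m b))) r cs None
  | Some (Read d a) => Config p.+1 (upd m d (m (m a))) r cs None
  | Some (Write a b) => Config p.+1 (upd m (m a) (m b)) r cs None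
  | Some (Rand d) => Config p.+1 (upd m d (head 0 r)) (behead r) cs None
  | Some (Call d i j l) =>
      let q := (m i, m j, m l) in
      Config p.+1 (upd m d (ans q %% 2 ^ w)) r (rcons cs q) None
  | Some (JumpLt a b t) => Config (if m a < m b then t else p.+1) m r cs None
  | Some (Halt a) => Config p m r cs (Some (m a != 0))
  end.

Definition init (n alpha beta phi : nat) (r : seq nat) : config :=
  Config 0 (nth 0 [:: n; alpha; beta; phi]) r [::] None.

(* [T] steps of [P]; each step reads at most one random word, so [T] of them
   are enough. *)
Definition run (P : program) (w n alpha beta phi T : nat)
  (r : T.-tuple 'I_(2 ^ w)) (ans : query -> bool) : config :=
  iter T (step P w ans)
    (init n alpha beta phi [seq nat_of_ord x | x <- r]).

Definition solves (T : Type) (alpha beta : nat) (x y : seq T) (s : config) :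
  bool :=
  if output s is Some b then gap_correct alpha beta x y b else false.

Local Open Scope ring_scope.

Definition prob_unif (R : realType) (Omega : finType) (E : pred Omega) : R :=
  #|E|%:R / #|Omega|%:R.

Definition log2 (R : realType) (x : R) : R := ln x / ln 2.

(* Main.v *)
(* Cut the strings at the same multiples of [L = phi * 2 ^ k], for every k, and
   call a block bad when its two sides are at edit distance more than [phi].
   Since both strings have the same length, a pair of aligned blocks is never
   farther apart than the strings themselves, so every oracle answer is YES when
   [ED X Y <= beta]. Conversely, the blocks of length [phi] are good, and the
   total excess of the block distances over [phi] grows, from one level to the
   next, by at most [phi] per bad block; hence [alpha < ED X Y] forces about
   [alpha / phi] bad blocks in all levels together. Sampling [16 n / (alpha 2^k)]
   uniform blocks on level k, for as long as this is at least 1, gives an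
   expected number of bad samples of at least 1, and by independence the
   probability to miss all bad blocks is at most
   [prod (1 - p_s) <= exp (- sum p_s) <= 1 / e]. Reducing a random word modulo
   the number of blocks is not exactly uniform; a factor 2 absorbs the bias. *)
Require Import Defs.
From HB Require Import structures.
From mathcomp Require Import all_boot all_order all_algebra.
From mathcomp Require Import boolp reals sequences exp.
From mathcomp Require Import zify ring lra.

Import Order.TTheory GRing.Theory Num.Theory.
Local Open Scope ring_scope.

(** * Edit distance of blocks *)

Section EditDistanceTheory.
Variable T : Type.
Implicit Types (x y z u v : seq T) (i k l L : nat).
Local Open Scope nat_scope.

Lemma edits_trans k l x y z :
  edits k x y -> edits l y z -> edits (k + l) x z.
Proof.
move=> Exy Eyz; elim: Exy Eyz => [//|j a b c Sab _ IH] Ez.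
exact: EditsS Sab (IH Ez).
Qed.

Lemma edit_step_cat u v x y :
  edit_step x y -> edit_step (u ++ x ++ v) (u ++ y ++ v).
Proof.
by case=> [a c b|a c b|a c d b]; rewrite -!catA !cat_cons !(catA u);
   constructor.
Qed.

Lemma edits_cat2 u v k x y : edits k x y -> edits k (u ++ x ++ v) (u ++ y ++ v).
Proof.
elim=> [z|j a b c Sab _ IH]; first exact: Edits0.
exact: EditsS (edit_step_cat _ _ _ _ Sab) IH.
Qed.

Lemma edits_cat k l x y u v :
  edits k x y -> edits l u v -> edits (k + l) (x ++ u) (y ++ v).
Proof.
move=> /(edits_cat2 [::] u) /= E1 /(edits_cat2 y [::]); rewrite !cats0.
exact: edits_trans.
Qed.

(** An edit at the very front turns into an edit of the next character: inserting or deleting [a]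
    before [c :: v] leaves tails that differ by [c] in front of [v]. A substitution there
    disappears. *)
Lemma edit_step_behead x y :
  edit_step x y -> behead x = behead y \/ edit_step (behead x) (behead y).
Proof.
case=> [[|b u] a v|[|b u] a v|[|c u] a b v] /=; try by right; constructor.
- case: v => [|c v]; first by left.
  by right; exact: (Insertion [::] c v).
- case: v => [|c v]; first by left.
  by right; exact: (Deletion [::] c v).
- by left.
Qed.

Lemma edit_step_rev x y : edit_step x y -> edit_step (rev x) (rev y).
Proof.
case=> [u a v|u a v|u a b v]; rewrite !rev_cat ?rev_cons ?cat_rcons;
  by constructor.
Qed.

Lemma ED_edits x y : edits (ED x y) x y.
Proof. by rewrite /ED; case: ex_minnP => k /asboolP. Qed.

Lemma ED_le k x y : edits k x y -> ED x y <= k.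
Proof. by rewrite /ED; case: ex_minnP => j _ jmin E; apply/jmin/asboolP. Qed.

Lemma ED_cat x y u v : ED (x ++ u) (y ++ v) <= ED x y + ED u v.
Proof. by apply/ED_le/edits_cat; exact: ED_edits. Qed.

Lemma edits_size x y : size x = size y -> edits (size x) x y.
Proof.
elim: x y => [|a x IH] [|b y] //= => [_|[/IH E]]; first exact: Edits0.
apply: EditsS (Substitution [::] a b x) _.
by have := edits_cat2 [:: b] [::] _ _ _ E; rewrite /= !cats0.
Qed.

Lemma ED_size x y : size x = size y -> ED x y <= size x.
Proof. by move=> /edits_size /ED_le. Qed.

Lemma ED_behead x y : ED (behead x) (behead y) <= ED x y.
Proof.
have := ED_edits x y; move: (ED x y) => k.
elim=> [z|j a b c Sab _ IH].
  by apply: ED_le; exact: Edits0.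
case: (edit_step_behead _ _ Sab) => [->|S]; first exact: leqW.
by apply: leq_trans (ED_le _ _ _ (EditsS S (ED_edits _ _))) _.
Qed.

Lemma ED_drop i x y : ED (drop i x) (drop i y) <= ED x y.
Proof.
elim: i => [|i IH]; first by rewrite !drop0.
rewrite -addn1 addnC -!drop_drop !drop1.
exact: leq_trans (ED_behead _ _) IH.
Qed.

Lemma ED_rev x y : ED (rev x) (rev y) <= ED x y.
Proof.
apply: ED_le; have := ED_edits x y; move: (ED x y) => k.
elim=> [z|j a b c Sab _ IH]; first exact: Edits0.
exact: EditsS (edit_step_rev _ _ Sab) IH.
Qed.

(** A prefix is a reversed suffix; by the equal sizes, both reversals drop the same number of
    characters. *)
Lemma ED_take i x y :
  size x = size y -> ED (take i x) (take i y) <= ED x y.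
Proof.
move=> sxy; rewrite -[take i x]revK -[take i y]revK.
apply: leq_trans (ED_rev _ _) _.
rewrite !rev_take sxy; exact: leq_trans (ED_drop _ _ _) (ED_rev _ _).
Qed.

Lemma ED_substr i l x y :
  size x = size y -> ED (substr x i l) (substr y i l) <= ED x y.
Proof.
move=> sxy; apply: leq_trans (ED_drop i x y).
by apply: ED_take; rewrite !size_drop sxy.
Qed.

Lemma substrD x i l1 l2 :
  substr x i (l1 + l2) = substr x i l1 ++ substr x (i + l1) l2.
Proof. by rewrite /substr takeD drop_drop addnC. Qed.

(** In truncated subtraction [l - (l - s)] is [minn l s], and a [take] past the end takes no more.
    Thus a query can clip the incomplete last block to existing positions. *)
Lemma substr_clip x i l :
  substr x i (l - (l - (size x - i))) = substr x i l.
Proof.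
rewrite /substr -size_drop -minnE; case: (leqP l (size (drop i x))) => h //.
by rewrite take_size take_oversize // ltnW.
Qed.

(* The ceiling of [n / L]; always used with [0 < L]. *)
Definition nblocks (n L : nat) : nat := (n + L - 1) %/ L.

Lemma nblocks_gt0 n L : 0 < n -> 0 < L -> 0 < nblocks n L.
Proof. by move=> n0 L0; rewrite divn_gt0 //; lia. Qed.

Lemma leq_nblocks n L a : 0 < L -> n <= a * L -> nblocks n L <= a.
Proof.
by move=> L0 na; rewrite /nblocks -ltnS ltn_divLR // mulSn; lia.
Qed.

Lemma ltn_nblocks n L i : 0 < L -> i < nblocks n L -> i * L < n.
Proof. by move=> L0; rewrite leq_divRL // mulSn; lia. Qed.

Lemma nblocks_cover n L : 0 < L -> n <= nblocks n L * L.
Proof.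
move=> L0; have := ltn_ceil (n + L - 1) L0; rewrite -/(nblocks n L) mulSn; lia.
Qed.

Definition block_dist x y L i : nat :=
  ED (substr x (i * L) L) (substr y (i * L) L).

Lemma block_dist_double x y L i :
  block_dist x y (L + L) i <= block_dist x y L i.*2 + block_dist x y L i.*2.+1.
Proof.
rewrite /block_dist !substrD.
have -> : i * (L + L) = i.*2 * L by lia.
rewrite [in i.*2.+1 * L]mulSnr; exact: ED_cat.
Qed.

Lemma block_dist_size x y L i : size x = size y -> block_dist x y L i <= L.
Proof.
move=> sxy; apply: leq_trans (ED_size _ _ _) _.
  by rewrite !size_take !size_drop sxy.
by rewrite size_take; case: ltnP.
Qed.

Lemma block_dist_out x y L i :
  size x = size y -> size x <= i * L -> block_dist x y L i = 0.
Proof.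
move=> sxy si; rewrite /block_dist /substr !drop_oversize -?sxy //.
by apply/eqP; rewrite -leqn0; exact: ED_le (Edits0 _).
Qed.

Lemma ED_sum_blocks x y L a :
  size x = size y -> size x <= a * L ->
  ED x y <= \sum_(0 <= i < a) block_dist x y L i.
Proof.
move=> sxy sa; rewrite -{1}(take_oversize sa).
rewrite -{1}(@take_oversize _ (a * L) y) -?sxy //.
elim: a {sa} => [|a IH].
  by rewrite mul0n !take0 (leq_trans (ED_le 0 _ _ (Edits0 _))).
rewrite big_nat_recr //= mulSnr !takeD.
apply: leq_trans (ED_cat _ _ _ _) _; rewrite leq_add2r //; exact: IH.
Qed.

Lemma sum_blocks n L (f : nat -> nat) a :
  0 < L -> (forall i, n <= i * L -> f i = 0) -> nblocks n L <= a ->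
  \sum_(0 <= i < a) f i = \sum_(0 <= i < nblocks n L) f i.
Proof.
move=> L0 f0 ma; rewrite (big_cat_nat (leq0n _) ma) //=.
rewrite [X in _ + X]big1_seq ?addn0 //.
move=> i /andP[_]; rewrite mem_index_iota => /andP[mi _]; apply: f0.
by apply: leq_trans (nblocks_cover n L L0) _; rewrite leq_mul2r mi orbT.
Qed.

Lemma sum_double (f : nat -> nat) a :
  \sum_(0 <= i < a) (f i.*2 + f i.*2.+1) = \sum_(0 <= i < a.*2) f i.
Proof.
elim: a => [|a IH]; first by rewrite !big_geq.
by rewrite doubleS !big_nat_recr //= IH addnA.
Qed.

Definition bad_blocks x y phi L : nat :=
  \sum_(0 <= i < nblocks (size x) L) (phi < block_dist x y L i).

(* Splitting a bad block creates at most [phi] more excess than its two halves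
   have, and splitting a good block creates none. *)
Lemma excess_bad_blocks x y phi k :
  size x = size y -> 0 < phi ->
  let L := phi * 2 ^ k in
  \sum_(0 <= i < nblocks (size x) L) (block_dist x y L i - phi) <=
  phi * \sum_(0 <= j < k.+1) bad_blocks x y phi (phi * 2 ^ j).
Proof.
move=> sxy phi0; elim: k => [|k IH] /=.
  rewrite big1_seq // => i _; apply/eqP; rewrite subn_eq0.
  by rewrite expn0 muln1 block_dist_size.
set L := phi * 2 ^ k in IH *.
have L0 : 0 < L by rewrite muln_gt0 phi0 expn_gt0.
have EL : phi * 2 ^ k.+1 = L + L by rewrite expnS /L; lia.
rewrite big_nat_recr //= mulnDr EL {1}/bad_blocks.
set m := nblocks _ (L + L).
apply: leq_trans (leq_add IH (leqnn _)).
(* [m.*2] can exceed the number of blocks of length [L] by one; the extra block is empty and has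
   distance 0. *)
rewrite -(@sum_blocks _ L _ m.*2) //; first 1 last.
- by move=> i si; rewrite block_dist_out.
- apply: leq_nblocks => //; have := @nblocks_cover (size x) (L + L).
  rewrite -/m; lia.
rewrite -sum_double big_distrr -big_split /=; apply: leq_sum => i _.
have := block_dist_double x y L i.
by case: ltnP; lia.
Qed.

(** Each block of the largest length costs at most [phi] plus its excess, and the bad blocks of all
    levels pay for the excesses. *)
Lemma ED_bad_blocks x y phi k :
  size x = size y -> 0 < phi ->
  ED x y <= phi * (nblocks (size x) (phi * 2 ^ k)
                   + \sum_(0 <= j < k.+1) bad_blocks x y phi (phi * 2 ^ j)).
Proof.
move=> sxy phi0; have := excess_bad_blocks x y phi k sxy phi0 => /=.
set L := phi * 2 ^ k => exc.
have L0 : 0 < L by rewrite muln_gt0 phi0 expn_gt0.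
apply: leq_trans (ED_sum_blocks x y L _ sxy (nblocks_cover _ _ L0)) _.
rewrite mulnDr; apply: leq_trans (leq_add (leqnn _) exc).
have -> : phi * nblocks (size x) L = \sum_(0 <= i < nblocks (size x) L) phi.
  by rewrite sum_nat_const_nat subn0 mulnC.
rewrite -big_split /=; apply: leq_sum => i _; lia.
Qed.

End EditDistanceTheory.

(** * The program *)

(* Memory layout: 0 n, 1 alpha, 3 block length, 4 the constant 1, 5 conjunction
   of the answers, 6 samples per level, 7 the constant 2, 8 samples left,
   9 number of blocks, 10-13 scratch, 14 the constant 0. *)
Definition sampler : program :=
  [:: Const 5 1;
      JumpLt 1 0 3;
      Halt 5;
      Const 4 16;
      Op Mul 6 4 0;
      Op Div 6 6 1;
      Const 4 1;
      Const 7 2;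
      (* 8, next level *)
      JumpLt 14 6 10;
      Halt 5;
      Op Add 8 6 14;
      Op Add 9 0 3;
      Op Defs.Sub 9 9 4;
      Op Div 9 9 3;
      (* 14, next sample *)
      Rand 10;
      Op Mod 10 10 9;
      Op Mul 11 10 3;
      Op Defs.Sub 12 0 11;
      Op Defs.Sub 12 3 12;
      Op Defs.Sub 12 3 12;
      Call 13 11 11 12;
      Op Mul 5 5 13;
      Op Defs.Sub 8 8 4;
      JumpLt 14 8 14;
      Op Add 3 3 3;
      Op Div 6 6 7;
      JumpLt 14 4 8].

(** * Execution of the program, loop by loop *)

Section Run.
Local Open Scope nat_scope.

(* The length is [minn L (n - start)], in the form computed by the machine. *)
Definition sample_query (n L x : nat) : query :=
  let start := x %% nblocks n L * L in (start, start, L - (L - (n - start))).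

Fixpoint sample_queries (n : nat) (Ls r : seq nat) : seq query :=
  if Ls is L :: Ls' then
    sample_query n L (head 0 r) :: sample_queries n Ls' (behead r)
  else [::].

Lemma sample_queries_cat n Ls1 Ls2 r :
  sample_queries n (Ls1 ++ Ls2) r =
  sample_queries n Ls1 r ++ sample_queries n Ls2 (drop (size Ls1) r).
Proof.
elim: Ls1 r => [|L Ls IH] r /=; first by rewrite drop0.
by rewrite IH -drop1 drop_drop addn1.
Qed.

(** One entry per sample, in the order of execution; starting at an arbitrary level [k] lets an
    induction peel off the first level. *)
Definition level_lengths (phi B k j : nat) : seq nat :=
  flatten [seq nseq (B %/ 2 ^ i) (phi * 2 ^ i) | i <- iota k j].

Variables (n alpha phi w : nat) (ans : query -> bool).
Hypothesis n_gt0 : 0 < n.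

Definition loop_inv (m : nat -> nat) (L t : nat) (a : bool) : Prop :=
  [/\ [/\ m 0 = n, m 3 = L & m 4 = 1], m 5 = a, m 6 = t, m 7 = 2 & m 14 = 0].

Local Notation go := (step sampler w ans).

Lemma run_sample m r cs L t a c :
  loop_inv m L t a -> m 8 = c -> m 9 = nblocks n L ->
  0 < L -> 0 < c -> n + L < 2 ^ w -> c < 2 ^ w ->
  exists m', [/\ iter 10 go (Config 14 m r cs None) =
      Config (if 1 < c then 14 else 24) m' (behead r)
        (rcons cs (sample_query n L (head 0 r))) None,
    loop_inv m' L t (a && ans (sample_query n L (head 0 r))),
    m' 8 = c.-1 & m' 9 = nblocks n L].
Proof.
move=> [[m0 m3 m4] m5 m6 m7 m14] m8 m9 L0 c0 nLw cw.
have mle : nblocks n L <= n by apply: leq_nblocks => //; rewrite leq_pmulr.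
have m_gt0 := nblocks_gt0 n L n_gt0 L0.
set i := head 0 r %% nblocks n L.
have im : i < nblocks n L by rewrite ltn_mod.
have iLn := ltn_nblocks n L i L0 im.
have w1 : 1 < 2 ^ w by lia.
do 10 rewrite iterSr [step _ _ _ _]/=.
rewrite /= /upd /= /eval_op.
rewrite !m0 !m3 !m4 !m5 !m8 !m9 !m14 -/i.
(* Nothing wraps around: all intermediate values are bounded by [n], [L] or [c]. *)
rewrite [i %% _]modn_small; last by lia.
rewrite [(i * L) %% _]modn_small; last by lia.
rewrite [(n - _) %% _]modn_small; last by lia.
rewrite [(L - (n - _)) %% _]modn_small; last by lia.
rewrite [(L - (L - _)) %% _]modn_small; last by lia.
rewrite [(c - 1) %% _]modn_small; last by lia.
rewrite subn_gt0.
eexists; split; first by [].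
- split=> //=; have bit (b : bool) : b %% 2 ^ w = b.
    by rewrite modn_small //; case: b; lia.
  by rewrite -/i bit mulnb bit.
- by rewrite subn1.
- by [].
Qed.

Lemma run_samples m r cs L t a c :
  loop_inv m L t a -> m 8 = c.+1 -> m 9 = nblocks n L ->
  0 < L -> n + L < 2 ^ w -> c.+1 < 2 ^ w ->
  let qs := sample_queries n (nseq c.+1 L) r in
  exists m', iter (10 * c.+1) go (Config 14 m r cs None) =
      Config 24 m' (drop c.+1 r) (cs ++ qs) None
    /\ loop_inv m' L t (a && all ans qs).
Proof.
move=> inv m8 m9 L0 nLw.
elim: c m r cs a inv m8 m9 => [|c IH] m r cs a inv m8 m9 cw.
  have [m' [run inv' _ _]] := run_sample m r cs L t a 1 inv m8 m9 L0 isT nLw cw.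
  by exists m'; rewrite muln1 run cats1 drop1 [all _ _]andbT.
have [m' [run inv' m'8 m'9]] :=
  run_sample m r cs L t a c.+2 inv m8 m9 L0 isT nLw cw.
have [m'' [run' inv'']] := IH _ (behead r) (rcons cs (sample_query n L (head 0 r)))
  _ inv' m'8 m'9 (ltnW cw).
rewrite [nseq _ _]/= [sample_queries _ _ _]/=; exists m''.
rewrite mulnS addnC iterD run run'.
rewrite [all _ _]/= andbA; split=> //.
by rewrite -[behead r]drop1 drop_drop addn1 cat_rcons drop1.
Qed.

Lemma run_level m r cs L t a :
  loop_inv m L t.+1 a -> 0 < L -> n + (L + L) < 2 ^ w -> t.+1 < 2 ^ w ->
  2 < 2 ^ w ->
  let qs := sample_queries n (nseq t.+1 L) r in
  exists m', iter (8 + 10 * t.+1) go (Config 8 m r cs None) =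
      Config 8 m' (drop t.+1 r) (cs ++ qs) None
    /\ loop_inv m' (L + L) (t.+1 %/ 2) (a && all ans qs).
Proof.
move=> inv L0 nLw tw w2 qs.
have [[m0 m3 m4] m5 m6 m7 m14] := inv.
(* Five instructions (the test, the counter, three for the number of blocks) precede the sampling
   loop; three (double [L], halve the count, jump back) follow it. *)
rewrite (_ : 8 + 10 * t.+1 = 3 + 10 * t.+1 + 5); last by lia.
rewrite (iterD (3 + _) 5).
rewrite iterSr [step _ _ _ _]/= m14 m6 ltn0Sn.
do 4 rewrite iterSr [step _ _ _ _]/=.
rewrite [iter 0 _ _]/= (iterD 3).
set m1 := upd _ _ _.
have mle : nblocks n L <= n by apply: leq_nblocks => //; rewrite leq_pmulr.
have m18 : m1 8 = t.+1.
  by rewrite /m1 /upd /= /eval_op m6 m14 addn0 modn_small.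
have m19 : m1 9 = nblocks n L.
  rewrite /m1 /upd /= /eval_op m0 m3 m4.
  rewrite modn_small ?[(n + L) %% _]modn_small //; try lia.
    by rewrite modn_small // /nblocks; lia.
  rewrite [(n + L - 1) %% _]modn_small; last by lia.
  by rewrite -/(nblocks n L); lia.
have inv1 : loop_inv m1 L t.+1 a by [].
have [|m2 [run [[n0 n3 n4] n5 n6 n7 n14]]] :=
  run_samples m1 r cs L t.+1 a t inv1 m18 m19 L0 _ tw.
  lia.
rewrite run; do 3 rewrite iterSr [step _ _ _ _]/=.
rewrite [iter 0 _ _]/=; set m' := upd _ _ _.
have [e14 e4] : m' 14 = 0 /\ m' 4 = 1 by rewrite /m' /upd.
rewrite e14 e4; exists m'; split; first by [].
rewrite /m' /loop_inv /upd /= /eval_op n3 n6 n7 !modn_small //; lia.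
Qed.

(** Induction on the [j] levels left; the bounds on [B] say that the sample count first vanishes on
    level [k + j]. A level with [t >= 1] samples takes [8 + 10 * t <= 18 * t] steps; the final 2 are
    the failed test and [Halt]. *)
Lemma run_levels B k j m r cs a :
  loop_inv m (phi * 2 ^ k) (B %/ 2 ^ k) a -> 0 < phi ->
  B < 2 ^ (k + j) -> (forall i, i < k + j -> 2 ^ i <= B) ->
  n + phi * 2 ^ (k + j) < 2 ^ w -> B < 2 ^ w -> 2 < 2 ^ w ->
  let Ls := level_lengths phi B k j in
  let qs := sample_queries n Ls r in
  exists T s, [/\ T <= 2 + 18 * size Ls,
    iter T go (Config 8 m r cs None) = s,
    calls s = cs ++ qs & output s = Some (a && all ans qs)].
Proof.
move=> inv phi0 Blt Bge nw Bw w2.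
elim: j k m r cs a inv Blt Bge nw => [|j IH] k m r cs a inv Blt Bge nw.
  have [[m0 m3 m4] m5 m6 m7 m14] := inv.
  exists 2; eexists; split; first by []; first by [].
    by rewrite /= m14 m6 divn_small -1?[k]addn0 //= cats0.
  by rewrite /= m14 m6 divn_small -1?[k]addn0 //= m5 andbT; case: (a).
have t0 : 0 < B %/ 2 ^ k by rewrite divn_gt0 ?expn_gt0 // Bge //; lia.
case Et : (B %/ 2 ^ k) inv t0 => [//|t] inv _.
set L := phi * 2 ^ k in inv.
have EL : L + L = phi * 2 ^ k.+1 by rewrite expnS /L; lia.
have L0 : 0 < L by rewrite muln_gt0 phi0 expn_gt0.
have tw : t.+1 < 2 ^ w by rewrite -Et (leq_ltn_trans (leq_div _ _)).
have LL : L + L <= phi * 2 ^ (k + j.+1).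
  by rewrite EL leq_mul2l leq_exp2l // addnS ltnS leq_addr orbT.
have [|m' [run]] := run_level m r cs L t a inv L0 _ tw w2; first by lia.
rewrite EL -Et -divnMA -expnSr => inv'.
have [|||T [s [Tle run' cs' out']]] := IH k.+1 m' (drop t.+1 r)
  (cs ++ sample_queries n (nseq t.+1 L) r) _ inv'.
- by rewrite addSnnS.
- by move=> i; rewrite addSnnS; exact: Bge.
- by rewrite addSnnS.
exists (T + (8 + 10 * t.+1)), s; rewrite iterD run run' /= in cs' out' *.
rewrite /level_lengths /= -/(level_lengths phi B k.+1 j) Et -/L in cs' out' *.
split=> //.
- by rewrite size_cat size_nseq; lia.
- by rewrite cs' -catA sample_queries_cat size_nseq.
- by rewrite out' sample_queries_cat size_nseq all_cat andbA.
Qed.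

End Run.

Lemma step_halted P w ans s : output s != None -> step P w ans s = s.
Proof. by case: s => p m r cs [b|]. Qed.

Lemma iter_halted P w ans (T1 T2 : nat) s :
  (T1 <= T2)%N -> output (iter T1 (step P w ans) s) != None ->
  iter T2 (step P w ans) s = iter T1 (step P w ans) s.
Proof.
move=> le12 h; rewrite -(subnK le12) iterD.
elim: (T2 - T1)%N => [//|k IH]; by rewrite iterS IH step_halted.
Qed.

(** * Number and lengths of the samples *)

Section SampleCounts.
Local Open Scope nat_scope.

Definition level_samples (n alpha : nat) : nat := 16 * n %/ alpha.

Definition num_levels (n alpha : nat) : nat :=
  (trunc_log 2 (level_samples n alpha)).+1.

(** If [n <= alpha], strings of length [n] are never at distance more than [alpha], and YES is
    correct without any call. *)
Definition sample_lengths (n alpha phi : nat) : seq nat :=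
  if alpha < n then
    level_lengths phi (level_samples n alpha) 0 (num_levels n alpha)
  else [::].

Lemma sum_level_lengths (phi B K : nat) (f : nat -> nat) :
  \sum_(L <- level_lengths phi B 0 K) f L =
  \sum_(0 <= k < K) B %/ 2 ^ k * f (phi * 2 ^ k).
Proof.
rewrite /level_lengths big_flatten big_map /index_iota subn0.
by apply: eq_bigr => k _; rewrite big_nseq iter_addn_0 mulnC.
Qed.

(** Induction with [B %/ 2] in place of [B], since [B + 2 * (B %/ 2) <= 2 * B]. *)
Lemma sum_halves B K : \sum_(0 <= k < K) B %/ 2 ^ k <= 2 * B.
Proof.
elim: K B => [|K IH] B; first by rewrite big_geq.
rewrite big_nat_recl // divn1.
under eq_bigr do rewrite expnS divnMA.
have := IH (B %/ 2); lia.
Qed.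

Variables (n alpha phi : nat).
Hypotheses (phi_gt0 : 0 < phi) (phi_le : 10 * phi <= alpha) (an : alpha < n).

Local Notation B := (level_samples n alpha).
Local Notation K := (num_levels n alpha).

Lemma alpha_gt0 : 0 < alpha. Proof. lia. Qed.

Lemma level_samples_le : B * alpha <= 16 * n.
Proof. exact: leq_divM. Qed.

Lemma level_samples_gt0 : 0 < B.
Proof. by rewrite divn_gt0 ?alpha_gt0 //; lia. Qed.

Lemma level_samples_lt : B < 2 ^ K.
Proof. exact: trunc_log_ltn. Qed.

Lemma expn_level_le k : k < K -> 2 ^ k <= B.
Proof.
rewrite ltnS => kK; rewrite (leq_trans _ (@trunc_logP 2 B isT level_samples_gt0)) //.
by rewrite leq_exp2l.
Qed.

(** On the last level, [10 * phi * 2 ^ K.-1 <= alpha * B <= 16 * n]. The machine doubles the length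
    once more after that level, so [phi * 2 ^ K] must fit in a word too. *)
Lemma max_length_le : 10 * (phi * 2 ^ K) <= 32 * n.
Proof.
have := expn_level_le K.-1 (ltnSn _); rewrite /= => h.
have := level_samples_le; rewrite expnS.
have : 10 * phi * 2 ^ trunc_log 2 B <= alpha * B by exact: leq_mul.
lia.
Qed.

Lemma size_sample_lengths : size (sample_lengths n alpha phi) <= 2 * B.
Proof.
rewrite /sample_lengths an -sum1_size sum_level_lengths.
by under eq_bigr do rewrite muln1; exact: sum_halves.
Qed.

Lemma sum_sample_lengths :
  \sum_(L <- sample_lengths n alpha phi) L <= K * (phi * B).
Proof.
rewrite /sample_lengths an (sum_level_lengths _ _ _ id) -[K in K * _]subn0.
rewrite -sum_nat_const_nat; apply: leq_sum => k _.
by rewrite mulnCA leq_mul2l leq_divM orbT.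
Qed.

(** Uniform sampling would hit each block of level [k] at least [3 * phi / alpha] times on average.
    With [m] blocks and [t] samples, [m * phi * 2 ^ k <= n + phi * 2 ^ k], where
    [16 * n < 2 * t * 2 ^ k * alpha] and [10 * phi <= alpha]; the constants fit because 3 (1/8 +
    1/10) < 1. *)
Lemma nblocks_level k :
  k < K -> 3 * phi * nblocks n (phi * 2 ^ k) <= alpha * (B %/ 2 ^ k).
Proof.
move=> kK; have P0 : 0 < 2 ^ k by rewrite expn_gt0.
have kB := expn_level_le k kK.
have t0 : 0 < B %/ 2 ^ k by rewrite divn_gt0.
have Bt := ltn_ceil B P0.
have nB := ltn_ceil (16 * n) alpha_gt0; rewrite -/B in nB.
have mL : nblocks n (phi * 2 ^ k) * (phi * 2 ^ k) <= n + phi * 2 ^ k.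
  by apply: leq_trans (leq_divM _ _) _; lia.
have aP : alpha * 2 ^ k <= 16 * n.
  by apply: leq_trans level_samples_le; rewrite mulnC leq_mul2r kB orbT.
have pP : 10 * phi * 2 ^ k <= alpha * 2 ^ k by rewrite leq_mul2r phi_le orbT.
rewrite -(leq_pmul2r P0).
move: mL t0 Bt; move: (nblocks _ _) (B %/ 2 ^ k) => m t mL t0 Bt.
have : B.+1 * alpha <= t.+1 * 2 ^ k * alpha by rewrite leq_mul2r Bt orbT.
have : t.+1 * 2 ^ k * alpha <= 2 * t * 2 ^ k * alpha.
  by rewrite !leq_mul2r; apply/orP; right; apply/orP; right; lia.
lia.
Qed.

(** Every residue has at least [N %/ m] representatives below [N], and [m <= N] gives
    [N < 2 * m * (N %/ m)]. *)
Lemma count_residues (N m : nat) (f : nat -> bool) : 0 < m -> m <= N ->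
  (\sum_(0 <= i < m) f i) * N <= 2 * m * #|[pred x : 'I_N | f (x %% m)]|.
Proof.
move=> m0 mN.
have -> : #|[pred x : 'I_N | f (x %% m)]| = \sum_(0 <= x < N) f (x %% m).
  by rewrite -sum1_card big_mkcond big_mkord /=; apply: eq_bigr => x _;
    rewrite inE; case: (f _).
have qE q : \sum_(0 <= x < q * m) f (x %% m) = q * \sum_(0 <= i < m) f i.
  elim: q => [|q IH]; first by rewrite big_geq.
  rewrite mulSn (@big_cat_nat _ _ _ m) ?leq_addr //= mulSn; congr (_ + _).
    by rewrite !big_nat; apply: eq_bigr => i /andP[_ im]; rewrite modn_small.
  rewrite -IH -{1}[m]add0n big_addn addKn.
  by apply: eq_bigr => i _; rewrite modnDr.
have le_q : N %/ m * m <= N by exact: leq_divM.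
have : \sum_(0 <= x < N %/ m * m) f (x %% m) <= \sum_(0 <= x < N) f (x %% m).
  by rewrite [X in _ <= X](big_cat_nat (leq0n _) le_q) leq_addr.
rewrite qE => /(leq_mul (leqnn (2 * m))); apply: leq_trans.
rewrite mulnA mulnC leq_mul2r; apply/orP; right.
have := ltn_ceil N m0; have : 0 < N %/ m by rewrite divn_gt0.
rewrite mulSn; nia.
Qed.

(** Divided by [N], this is the lower bound 1 on the expected number of bad samples. The top level
    has at most one sample, so its blocks account for at most [alpha / 3] of the distance; the bad
    blocks must supply the remaining [2 * alpha / 3]. *)
Lemma bad_words_total (T : Type) (x y : seq T) (N : nat) :
  size x = n -> size y = n -> alpha < ED x y -> n <= N ->
  N <= \sum_(L <- sample_lengths n alpha phi)
         #|[pred u : 'I_N | phi < block_dist T x y L (u %% nblocks n L)]|.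
Proof.
move=> sx sy aED nN.
have K0 : K.-1 < K by [].
have := ED_bad_blocks T x y phi K.-1 _ phi_gt0; rewrite sx sy => /(_ erefl).
rewrite [K.-1.+1]/= -/K => /(leq_trans aED) lower.
have top := nblocks_level K.-1 K0.
have t1 : B %/ 2 ^ K.-1 <= 1.
  rewrite -ltnS ltn_divLR ?expn_gt0 // -expnS; exact: level_samples_lt.
rewrite /sample_lengths an sum_level_lengths.
set S := \sum_(_ <= _ < _) _ in lower; set W := \sum_(_ <= _ < _) _.
(* Level by level, [count_residues] loses the factor 2 and [nblocks_level] trades [3 * phi] per
   block for [alpha] per sample. *)
have le_SW : 3 * phi * S * N <= 2 * alpha * W.
  rewrite /S /W mulnAC !big_distrr /= !big_nat; apply: leq_sum => k /andP[_ kK].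
  have L0 : 0 < phi * 2 ^ k by rewrite muln_gt0 phi_gt0 expn_gt0.
  have m0 : 0 < nblocks n (phi * 2 ^ k) by apply: nblocks_gt0 => //; lia.
  have mN : nblocks n (phi * 2 ^ k) <= N.
    by apply: leq_trans nN; apply: leq_nblocks => //; exact: leq_pmulr.
  have := count_residues N _ (fun i => phi < block_dist T x y (phi * 2 ^ k) i) m0 mN.
  rewrite /bad_blocks sx; set b := \sum_(_ <= _ < _) _; set c := #|_| => bc.
  have := leq_mul (nblocks_level k kK) (leqnn (2 * c)).
  have := leq_mul (leqnn (3 * phi)) bc.
  rewrite -/c; lia.
have : alpha * (B %/ 2 ^ K.-1) <= alpha * 1 by rewrite leq_mul2l t1 orbT.
move=> at1; have lo : 2 * alpha <= 3 * phi * S by rewrite mulnDr in lower; lia.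
have a0 := alpha_gt0.
have : 2 * alpha * N <= 2 * alpha * W.
  by apply: leq_trans le_SW; rewrite leq_mul2r lo orbT.
by rewrite leq_pmul2l //; lia.
Qed.

End SampleCounts.

(** Of the 9 extra steps, 7 prepare the first level and 2 end the last one. *)
Lemma run_sampler (n alpha beta phi w T : nat) (r : T.-tuple 'I_(2 ^ w))
    (ans : query -> bool) :
  (0 < phi)%N -> (10 * phi <= alpha)%N -> ((n + alpha) ^ 2 < 2 ^ w)%N ->
  (9 + 18 * size (sample_lengths n alpha phi) <= T)%N ->
  let s := run sampler n alpha beta phi r ans in
  let qs := sample_queries n (sample_lengths n alpha phi)
              [seq nat_of_ord x | x <- r] in
  calls s = qs /\ output s = Some (all ans qs).
Proof.
move=> phi0 pa nw.
have w16 : (16 < 2 ^ w)%N.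
  apply: leq_ltn_trans nw.
  by apply: (@leq_trans (10 ^ 2)); rewrite ?leq_exp2r //; lia.
suff H : exists T' s, [/\ (T' <= 9 + 18 * size (sample_lengths n alpha phi))%N,
    iter T' (step sampler w ans) (init n alpha beta phi
      [seq nat_of_ord x | x <- r]) = s,
    calls s = sample_queries n (sample_lengths n alpha phi)
      [seq nat_of_ord x | x <- r]
    & output s = Some (all ans (sample_queries n (sample_lengths n alpha phi)
      [seq nat_of_ord x | x <- r]))].
  case: H => T' [s [T'le run_s cs out]] leT.
  have -> /= : run sampler n alpha beta phi r ans = s.
    rewrite /run (@iter_halted _ _ _ T') ?run_s ?out //.
    exact: leq_trans leT.
  by [].
move: [seq nat_of_ord x | x <- r] => {}r.
rewrite /sample_lengths; case: ltnP => an; last first.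
  exists 3; eexists; split; first by []; first by [].
    by rewrite /= ltnNge an.
  by rewrite /= ltnNge an /= /upd /= modn_small //; lia.
set B := level_samples n alpha; set K := num_levels n alpha.
(* Here [n > alpha >= 10], so [n + alpha >= 16] and the square dominates [16 * n]. *)
have nw16 : (16 * n < 2 ^ w)%N.
  by apply: leq_ltn_trans nw; rewrite expnS expn1; apply: leq_mul; lia.
have maxL := max_length_le n alpha phi phi0 pa an.
have Bw : (B < 2 ^ w)%N.
  by apply: leq_ltn_trans nw16; exact: leq_div.
set s0 := init _ _ _ _ _.
have [m [runp inv]] : exists m, iter 7 (step sampler w ans) s0 =
    Config 8 m r [::] None /\ loop_inv n m (phi * 2 ^ 0) (B %/ 2 ^ 0) true.
  rewrite /s0 /init; do 2 rewrite iterSr [step _ _ _ _]/=.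
  have -> : upd (nth 0 [:: n; alpha; beta; phi]) 5 (1 %% 2 ^ w) 1 = alpha by [].
  have -> : upd (nth 0 [:: n; alpha; beta; phi]) 5 (1 %% 2 ^ w) 0 = n by [].
  rewrite an; do 5 rewrite iterSr [step _ _ _ _]/=.
  rewrite [iter 0 _ _]/=; eexists; split; first by [].
  rewrite /loop_inv /upd /= /eval_op muln1 divn1.
  by rewrite !(@modn_small _ (2 ^ w)) //; lia.
have [||||||T' [s [Tle runs cs out]]] :=
  run_levels n phi w ans _ B 0 K m r [::] true inv phi0.
- lia.
- exact: level_samples_lt.
- by move=> i; exact: (expn_level_le _ _ _ phi0 pa an).
- rewrite add0n -/K in maxL *; lia.
- by [].
- lia.
exists (T' + 7)%N, s; rewrite iterD runp; split=> //.
rewrite -/B -/K; lia.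
Qed.

(** * Independence of the samples and the error bound *)

Section Probability.
Variable R : realType.

(** Distinct samples read distinct words and are therefore independent; the unread end of the tape
    contributes a factor 1. *)
Lemma prob_sample_queries (n N : nat) (good : pred query) (Ls : seq nat)
    (T : nat) : (0 < N)%N -> (size Ls <= T)%N ->
  prob_unif R (fun r : T.-tuple 'I_N =>
    all good (sample_queries n Ls [seq nat_of_ord x | x <- r])) =
  \prod_(L <- Ls) prob_unif R (fun x : 'I_N => good (sample_query n L x)).
Proof.
move=> N0; elim: Ls T => [|L Ls IH] T.
  move=> _; rewrite big_nil /prob_unif /= divff // card_tuple card_ord.
  by rewrite pnatr_eq0 -lt0n expn_gt0 N0.
case: T => [//|T]; rewrite ltnS big_cons => /IH <-.
rewrite /prob_unif !card_tuple card_ord expnS natrM invfM mulrACA -natrM.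
congr (_%:R * _); rewrite -cardX -!sum1_card.
rewrite (reindex (fun p : 'I_N * T.-tuple 'I_N => cons_tuple p.1 p.2)).
  by apply: eq_bigl => -[x t]; rewrite !inE.
exists (fun t => (thead t, [tuple of behead t])) => [[x t] _|t _] /=.
  by congr pair; apply/val_inj.
by rewrite [RHS]tuple_eta; apply/val_inj.
Qed.

Lemma prob_unifC (Omega : finType) (E : pred Omega) : (0 < #|Omega|)%N ->
  prob_unif R E = 1 - prob_unif R (predC E).
Proof.
move=> O0; apply/eqP; rewrite eq_sym subr_eq /prob_unif -mulrDl -natrD cardC.
by rewrite divff // pnatr_eq0 -lt0n.
Qed.

Lemma prob_unif_le (Omega : finType) (E F : pred Omega) :
  (forall x, E x -> F x) -> prob_unif R E <= prob_unif R F.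
Proof.
move=> EF; rewrite ler_wpM2r ?invr_ge0 // ler_nat.
by apply/subset_leq_card/subsetP => x; exact: EF.
Qed.

Lemma prod_prob_le_expR (Omega : finType) (I : Type) (s : seq I)
    (E : I -> pred Omega) : (0 < #|Omega|)%N ->
  (#|Omega| <= \sum_(i <- s) #|predC (E i)|)%N ->
  \prod_(i <- s) prob_unif R (E i) <= (expR 1)^-1.
Proof.
move=> O0 le_sum.
have O0' : 0 < #|Omega|%:R :> R by rewrite ltr0n.
apply: (@le_trans _ _ (\prod_(i <- s) expR (- prob_unif R (predC (E i))))).
  apply: ler_prod => i _; rewrite divr_ge0 //= prob_unifC //.
  exact: expR_ge1Dx.
rewrite -expR_sum -expRN ler_expR sumrN lerN2.
rewrite -mulr_suml -natr_sum ler_pdivlMr // mul1r ler_nat.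
exact: le_sum.
Qed.

End Probability.

(** * The reduction *)

Section Queries.
Local Open Scope nat_scope.

Lemma valid_sample_query n L x :
  0 < n -> 0 < L -> valid_query n (sample_query n L x).
Proof.
move=> n0 L0; rewrite /valid_query /sample_query.
have := ltn_nblocks n L (x %% nblocks n L) L0.
rewrite ltn_mod nblocks_gt0 // => /(_ isT); lia.
Qed.

Lemma all_sample_queries n (Ls r : seq nat) (good : pred query) :
  (forall L x, L \in Ls -> good (sample_query n L x)) ->
  all good (sample_queries n Ls r).
Proof.
elim: Ls r => [//|L Ls IH] r h /=; rewrite h ?mem_head //=.
by apply: IH => K x KLs; rewrite h // inE KLs orbT.
Qed.

Lemma size_sample_queries n Ls r : size (sample_queries n Ls r) = size Ls.
Proof. by elim: Ls r => [//|L Ls IH] r /=; rewrite IH. Qed.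

Lemma sum_query_length n Ls r :
  \sum_(q <- sample_queries n Ls r) query_length q <= 2 * \sum_(L <- Ls) L.
Proof.
elim: Ls r => [|L Ls IH] r; rewrite ?big_nil // !big_cons mulnDr.
by apply: leq_add (IH _); rewrite /query_length /sample_query; lia.
Qed.

Lemma sample_lengths_gt0 n alpha phi L :
  0 < phi -> L \in sample_lengths n alpha phi -> 0 < L.
Proof.
move=> phi0; rewrite /sample_lengths; case: ifP => // _ /flattenP[s].
case/mapP=> k _ ->; rewrite mem_nseq => /andP[_ /eqP ->].
by rewrite muln_gt0 phi0 expn_gt0.
Qed.

Lemma answers_sample_query (T : Type) (O : seq T -> seq T -> bool)
    (x y : seq T) L u : size x = size y ->
  let i := u %% nblocks (size x) L in
  answers O x y (sample_query (size x) L u) =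
  O (substr x (i * L) L) (substr y (i * L) L).
Proof.
move=> sxy /=; congr O; first exact: substr_clip.
by rewrite -[RHS]substr_clip -sxy.
Qed.

Lemma answers_sampleP (T : Type) phi beta (O : seq T -> seq T -> bool)
    (x y : seq T) L u : size x = size y -> gap_oracle phi beta O ->
  gap_correct phi beta (substr x (u %% nblocks (size x) L * L) L)
    (substr y (u %% nblocks (size x) L * L) L)
    (answers O x y (sample_query (size x) L u)).
Proof.
move=> sxy gO; rewrite answers_sample_query //; apply: gO.
by rewrite !size_take !size_drop sxy.
Qed.

End Queries.

Lemma log2_nat_ge0 (R : realType) (n : nat) : 0 <= log2 n%:R :> R.
Proof.
rewrite /log2 divr_ge0 //; last by rewrite ln_ge0 // ler1n.
case: n => [|n]; first by rewrite ln0.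
by rewrite ln_ge0 // ler1n.
Qed.

(** By [max_length_le], [2 ^ K] is at most [3.2 * n] for [K] levels, hence at most [n ^ 2] since
    [n >= 11]. *)
Lemma num_levels_le_log2 (R : realType) (n alpha phi : nat) :
  (0 < phi)%N -> (10 * phi <= alpha)%N -> (alpha < n)%N ->
  (num_levels n alpha)%:R <= 2 * log2 n%:R :> R.
Proof.
move=> phi0 pa an; have maxL := max_length_le n alpha phi phi0 pa an.
have n0 : 0 < n%:R :> R by rewrite ltr0n; lia.
have ln2 : 0 < ln 2 :> R by rewrite ln_gt0 // ltr1n.
rewrite /log2 mulrA ler_pdivlMr // !mulr_natl -!lnXn //.
rewrite ler_ln ?posrE ?exprn_gt0 // -!natrX ler_nat.
have : (2 ^ num_levels n alpha <= phi * 2 ^ num_levels n alpha)%N.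
  exact: leq_pmull.
have : (11 * n <= n * n)%N by rewrite leq_mul2r; lia.
rewrite expnS expn1; lia.
Qed.

Theorem theorem3p2 (R : realType) :
  exists (P : program) (c : nat) (C : R),
    (0 < c)%N /\ 0 < C /\
    forall n alpha beta phi w : nat,
      (0 < phi)%N ->
      phi%:R <= alpha%:R / 10 :> R -> (beta <= phi)%N -> (1 <= beta)%N ->
      ((n + alpha) ^ c < 2 ^ w)%N ->
      exists T : nat,
        T%:R <= C * Num.max 1 (n%:R / alpha%:R) /\
        (forall (r : T.-tuple 'I_(2 ^ w)) (ans : query -> bool),
          let s := run P n alpha beta phi r ans in
          [/\ output s != None,
              all (valid_query n) (calls s),
              (size (calls s))%:R <= C * (n%:R / alpha%:R) &
              (\sum_(q <- calls s) query_length q)%N%:R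
                <= C * (phi%:R * n%:R * log2 n%:R / alpha%:R)]) /\
        (forall (r : T.-tuple 'I_(2 ^ w)) (ans1 ans2 : query -> bool),
          calls (run P n alpha beta phi r ans1)
            =i calls (run P n alpha beta phi r ans2)) /\
        (forall (Sigma : eqType) (X Y : n.-tuple Sigma)
            (O : seq Sigma -> seq Sigma -> bool),
          gap_oracle phi beta O ->
          prob_unif R
            (fun r : T.-tuple 'I_(2 ^ w) =>
              ~~ solves alpha beta X Y
                   (run P n alpha beta phi r (answers O X Y)))
            <= (expR 1)^-1).
Proof.
(* The running time needs the largest constant: [9 + 36 * B] is at most [9 + 576 * n / alpha], and 9
   + 576 = 585. *)
exists sampler, 2, 600; split=> //; split=> //.
move=> n alpha beta phi w phi0 phi_le bp b1 nw.
have pa : (10 * phi <= alpha)%N.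
  by move: phi_le; rewrite ler_pdivlMr // -natrM ler_nat mulnC.
have a0 : 0 < alpha%:R :> R by rewrite ltr0n; lia.
set Ls := sample_lengths n alpha phi; set B := level_samples n alpha.
have Ba : B%:R <= 16 * (n%:R / alpha%:R) :> R.
  rewrite mulrA ler_pdivlMr // -!natrM ler_nat; exact: level_samples_le.
have na0 : 0 <= n%:R / alpha%:R :> R by rewrite divr_ge0.
have szLs : (size Ls <= 2 * B)%N.
  rewrite /Ls; case: (ltnP alpha n) => an; first exact: size_sample_lengths.
  by rewrite /sample_lengths ltnNge an.
have szT : (9 + 18 * size Ls <= 9 + 36 * B)%N by lia.
exists (9 + 36 * B)%N.
have runE r ans := run_sampler n alpha beta phi w (9 + 36 * B) r ans phi0 pa nw szT.
split; last split; last split.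
- rewrite natrD natrM.
  have : 1 <= Num.max 1 (n%:R / alpha%:R) :> R by rewrite le_max lexx.
  have : n%:R / alpha%:R <= Num.max 1 (n%:R / alpha%:R) :> R.
    by rewrite le_max lexx orbT.
  move: (Num.max _ _) => M; lra.
- move=> r ans /=; have [-> ->] := runE r ans.
  split=> //.
  + apply: all_sample_queries => L x LLs; apply: valid_sample_query.
      by move: LLs; rewrite /Ls /sample_lengths; case: ltnP => //; lia.
    exact: sample_lengths_gt0 LLs.
  + rewrite size_sample_queries; apply: (@le_trans _ _ (2 * B)%:R).
      by rewrite ler_nat.
    rewrite natrM; lra.
  + have lens := sum_query_length n Ls [seq nat_of_ord x | x <- r].
    have [an|na] := ltnP alpha n; last first.
      have -> : \sum_(q <- sample_queries n Ls [seq nat_of_ord x | x <- r])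
          query_length q = 0%N.
        move: lens; rewrite /Ls /sample_lengths ltnNge na /= big_nil //.
      have := log2_nat_ge0 R n; move: (log2 _) => l l0.
      by rewrite !mulr_ge0 ?invr_ge0.
    have := sum_sample_lengths n alpha phi an; rewrite -/Ls -/B => sumLs.
    apply: (@le_trans _ _ (2 * (num_levels n alpha * (phi * B)))%:R).
      by rewrite ler_nat; apply: leq_trans lens _; rewrite leq_mul2l.
    rewrite !natrM.
    have Klog := num_levels_le_log2 R n alpha phi phi0 pa an.
    have KB := ler_pM (ler0n _ _) (ler0n _ _) Klog Ba.
    have phi0' : 0 <= phi%:R :> R by [].
    have := ler_wpM2l phi0' KB.
    have : 0 <= phi%:R * (log2 n%:R * (n%:R / alpha%:R)) :> R.
      have := log2_nat_ge0 R n; move: (log2 _) => l l0.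
      by rewrite !mulr_ge0 ?invr_ge0.
    set l := log2 _; set q := n%:R / _.
    have -> : phi%:R * n%:R * l / alpha%:R = phi%:R * (l * q) :> R.
      by rewrite /q; ring.
    have -> : phi%:R * (2 * l * (16 * q)) = 32 * (phi%:R * (l * q)) :> R by ring.
    have -> : 2 * ((num_levels n alpha)%:R * (phi%:R * B%:R)) =
      2 * (phi%:R * ((num_levels n alpha)%:R * B%:R)) :> R by ring.
    lra.
(* The calls are a function of the tape alone. *)
- by move=> r ans1 ans2; rewrite (runE r ans1).1 (runE r ans2).1.
move=> Sigma X Y O gO.
have sX : size X = n by rewrite size_tuple.
have sXY : size X = size Y by rewrite !size_tuple.
have N0 : (0 < 2 ^ w)%N by rewrite expn_gt0.
(* The error is one-sided: if the distance is at most [beta], so is that of every sampled pair, and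
   all answers are YES. *)
case: (leqP (ED X Y) alpha) => [EDa|aED].
  have p0 : prob_unif R (pred0 : pred ((9 + 36 * B).-tuple 'I_(2 ^ w))) = 0.
    by rewrite /prob_unif card0 mul0r.
  apply: (@le_trans _ _ 0); last by rewrite invr_ge0 expR_ge0.
  rewrite -p0; apply: prob_unif_le => r; apply/contraR => _.
  rewrite /solves (runE r _).2 /gap_correct [(alpha < _)%N]ltnNge EDa andbT.
  apply/implyP => EDb; apply: all_sample_queries => L u _.
  have /andP[/implyP h _] := answers_sampleP _ _ _ _ _ _ L u sXY gO.
  rewrite sX in h; apply: h; apply: leq_trans EDb; exact: ED_substr.
have an : (alpha < n)%N.
  by apply: leq_trans aED _; rewrite -[X in (_ <= X)%N]sX; exact: ED_size.
have nN : (n <= 2 ^ w)%N.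
  by apply/ltnW/(leq_ltn_trans _ nw); rewrite expnS expn1; nia.
pose good := answers O X Y.
(* On a NO instance, an error means that every sample was answered YES. *)
apply: (@le_trans _ _ (prob_unif R (fun r : (9 + 36 * B).-tuple 'I_(2 ^ w) =>
    all good (sample_queries n Ls [seq nat_of_ord x | x <- r])))).
  apply: prob_unif_le => r; rewrite /solves (runE r _).2 /gap_correct aED /=.
  by rewrite [(ED X Y <= beta)%N]leqNgt (leq_ltn_trans _ aED) /= ?negbK //; lia.
rewrite prob_sample_queries //; last by lia.
apply: prod_prob_le_expR; rewrite card_ord //.
apply: leq_trans (bad_words_total n alpha phi phi0 pa an Sigma X Y _ sX _ aED nN) _.
  by rewrite size_tuple.
(* A bad block forces the answer NO, so bad words are among those answered NO. *)
apply: leq_sum => L _; apply/subset_leq_card/subsetP => u; rewrite !inE => bad.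
have /andP[_ /implyP] := answers_sampleP _ _ _ _ _ _ L u sXY gO.
by rewrite sX; apply.
Qed.
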